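(* For every integer $N\ge 3$, $\overline{\mathcal{H}}\neq\mathcal{E}^c$ in $\mathrm{SL}(2,\mathbb{R})^N$, where $\mathcal{H}$ is the hyperbolic locus, $\mathcal{E}$ is the elliptic locus, $\overline{\mathcal{H}}$ is the closure of $\mathcal{H}$ and $\mathcal{E}^c$ is the complement of $\mathcal{E}$.
   Context: $\mathrm{SL}(2,\mathbb{R})^N$ carries the product topology and $\|\cdot\|$ is a matrix norm. An $N$-tuple $(A_1,\dots,A_N)\in\mathrm{SL}(2,\mathbb{R})^N$ is uniformly hyperbolic if there exist constants $\lambda>1$ and $C>0$ such that $\|A_{i_n}A_{i_{n-1}}\cdots A_{i_0}\|\ge C\lambda^n$ for every sequence $(i_n)$ in $\{1,\dots,N\}$ and all $n\in\mathbb{N}$. The hyperbolic locus $\mathcal{H}$ is the set of all uniformly hyperbolic $N$-tuples. A matrix $A\in\mathrm{SL}(2,\mathbb{R})$ is elliptic if $|\operatorname{tr}A|<2$. The elliptic locus $\mathcal{E}$ is the set of $N$-tuples $(A_1,\dots,A_N)\in\mathrm{SL}(2,\mathbb{R})^N$ for which the semigroup of matrices generated by $\{A_1,\dots,A_N\}$ (nonempty products) contains either the identity matrix or an elliptic matrix. *)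

(* Defs.v *)
From HB Require Import structures.
From mathcomp Require Import all_boot all_order all_algebra.
From mathcomp Require Import all_classical all_reals all_analysis.

Set Implicit Arguments.
Unset Strict Implicit.
Unset Printing Implicit Defensive.

Import Order.TTheory GRing.Theory Num.Theory.
Import numFieldNormedType.Exports.

Local Open Scope classical_set_scope.
Local Open Scope ring_scope.

(* As a type, SL2 R is [set_type (SL2 R)], which carries the topology induced
   from 'M[R]_2. *)
Definition SL2 (R : realType) : set 'M[R]_2 := [set A | \det A = 1].
Arguments SL2 : clear implicits.

(* {ptws _ -> _} is the product topology.  The indices 1, ..., N are
   represented by 0, ..., N - 1. *)
Definition SL2_tuple (R : realType) (N : nat) : topologicalType :=
  {ptws 'I_N -> set_type (SL2 R)}.

(* A norm on the vector space of 2 x 2 matrices.  Submultiplicativity is not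
   required, so this covers operator norms as well as entrywise norms. *)
Record is_matrix_norm (R : realType) (nrm : 'M[R]_2 -> R) : Prop :=
  IsMatrixNorm {
    matrix_norm_ge0 : forall A, 0 <= nrm A;
    matrix_norm_eq0 : forall A, nrm A = 0 -> A = 0;
    matrix_normZ : forall (c : R) A, nrm (c *: A) = `|c| * nrm A;
    matrix_normD : forall A B, nrm (A + B) <= nrm A + nrm B }.

(* The product is A_(i_n) * A_(i_(n-1)) * ... * A_(i_0), with n + 1 factors. *)
Definition uniformly_hyperbolic (R : realType) (nrm : 'M[R]_2 -> R) (N : nat)
    (A : SL2_tuple R N) : Prop :=
  exists lambda C : R, [/\ 1 < lambda, 0 < C &
    forall (i : nat -> 'I_N) (n : nat),
      C * lambda ^+ n <= nrm (\prod_(k < n.+1) set_val (A (i (n - k)%N)))].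

Definition hyperbolic_locus (R : realType) (nrm : 'M[R]_2 -> R) (N : nat) :
    set (SL2_tuple R N) :=
  [set A | uniformly_hyperbolic nrm A].
Arguments hyperbolic_locus {R} nrm N.

Definition elliptic (R : realType) (A : 'M[R]_2) : Prop :=
  SL2 R A /\ `|\tr A| < 2.

Definition generated_semigroup (R : realType) (N : nat) (A : SL2_tuple R N) :
    set 'M[R]_2 :=
  [set M | exists2 w : seq 'I_N, w != [::] & M = \prod_(j <- w) set_val (A j)].

Definition elliptic_locus (R : realType) (N : nat) : set (SL2_tuple R N) :=
  [set A | exists2 M, generated_semigroup A M & M = 1%:M \/ elliptic M].
Arguments elliptic_locus : clear implicits.

(* Main.v *)
(* Take three upper triangular matrices: a contraction of the real line fixing
   0 and two expansions fixing -1 and 1.  Since their multipliers 1/4 and 16/9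
   are multiplicatively independent, no nonempty product is the identity, and
   triangular matrices of positive diagonal are never elliptic.  But all three
   can be applied without leaving a neighbourhood of 0: for every tuple close to
   this one, a point of [-9/10, 9/10] always has an image in this interval both
   under a contraction and under one of the expansions.  Choosing to contract or
   to expand according to the derivative accumulated so far yields an infinite
   word along which the vector (0, 1) keeps bounded length, and the remaining
   shear grows at most linearly.  Linear growth excludes uniform hyperbolicity,
   so the tuple has a neighbourhood disjoint from the hyperbolic locus. *)

Require Import Defs.
From mathcomp Require Import all_boot all_order all_algebra.
From mathcomp Require Import all_classical all_reals all_analysis.
From mathcomp Require Import ring lra zify.

Set Implicit Arguments.
Unset Strict Implicit.
Unset Printing Implicit Defensive.

Import Order.TTheory GRing.Theory Num.Theory.
Import numFieldNormedType.Exports.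

Local Open Scope classical_set_scope.
Local Open Scope ring_scope.

Lemma forall_ord2 (P : 'I_2 -> Prop) : P 0 -> P 1 -> forall i, P i.
Proof.
move=> P0 P1 [[|[|//]] lt_i2].
- by rewrite (_ : Ordinal _ = 0) //; apply: val_inj.
- by rewrite (_ : Ordinal _ = 1) //; apply: val_inj.
Qed.

Lemma sum_ord2 (V : nmodType) (F : 'I_2 -> V) : \sum_i F i = F 0 + F 1.
Proof.
by rewrite !big_ord_recl big_ord0 addr0; congr (_ + F _); apply: val_inj.
Qed.

Section TwoByTwo.
Variable R : comPzRingType.
Implicit Types A B : 'M[R]_2.

Lemma mulmx2E A B i j : (A * B) i j = A i 0 * B 0 j + A i 1 * B 1 j.
Proof. by rewrite mxE sum_ord2. Qed.

Lemma det_mx2 A : \det A = A 0 0 * A 1 1 - A 0 1 * A 1 0.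
Proof.
rewrite (expand_det_row _ 0) sum_ord2 /cofactor !det_mx11 !mxE /=.
rewrite (_ : lift _ _ = 1); last exact: val_inj.
rewrite (_ : lift _ _ = 0); last exact: val_inj.
by rewrite expr0 expr1; ring.
Qed.

End TwoByTwo.

(** * The generators and their products *)

Definition mx2 (R : Type) (a b c d : R) : 'M[R]_2 :=
  \matrix_(i, j) if i == 0 then if j == 0 then a else b
                 else if j == 0 then c else d.

(* On the projective line, gen 0 is z |-> z / 4, while gen 1 and gen 2 are the
   expansions z |-> (16 z + 7) / 9 and z |-> (16 z - 7) / 9 with fixed points
   -1 and 1, which map [-1, 0] and [0, 1] respectively into [-1, 1]. *)
Definition gen (R : realFieldType) (k : nat) : 'M[R]_2 :=
  match k with
  | 0 => mx2 (1 / 2) 0 0 2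
  | 1 => mx2 (4 / 3) (7 / 12) 0 (3 / 4)
  | _ => mx2 (4 / 3) (- (7 / 12)) 0 (3 / 4)
  end.
Arguments gen : clear implicits.

Section Generators.
Variable R : realFieldType.

Lemma det_gen k : \det (gen R k) = 1.
Proof. by rewrite det_mx2; case: k => [|[|k]]; rewrite !mxE /=; field. Qed.

Lemma gen_prod_entries (w : seq nat) :
  let k := count (fun j => j != 0)%N w in let m := count_mem 0%N w in
  let M := \prod_(j <- w) gen R j in
  [/\ M 1 0 = 0, M 0 0 = (4 / 3) ^+ k * (1 / 2) ^+ m & M 0 0 * M 1 1 = 1].
Proof.
elim: w => [|j w] /=.
  by rewrite big_nil !mxE /= !expr0 !mulr1.
set M := \prod_(j <- w) _ => -[M10 M00 M11]; rewrite big_cons -/M.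
split.
- rewrite mulmx2E M10.
  by case: j => [|[|j]]; rewrite !mxE /= mul0r mulr0 addr0.
- rewrite mulmx2E M10 M00 mulr0 addr0.
  by case: j => [|[|j]]; rewrite !mxE /= ?add0n ?add1n exprS; ring.
- rewrite !mulmx2E M10 mulr0 addr0.
  have -> : gen R j 1 0 = 0 by case: j => [|[|j]]; rewrite !mxE.
  rewrite mul0r add0r mulrACA M11 mulr1.
  by case: j => [|[|j]]; rewrite !mxE /=; field.
Qed.

(** Clearing denominators gives [4 ^ k = 3 ^ k * 2 ^ m]; divisibility by 3 forces [k = 0], and then
    [m = 0]. *)
Lemma four_thirds_half_indep (k m : nat) :
  (4 / 3 : R) ^+ k * (1 / 2) ^+ m = 1 -> (k + m = 0)%N.
Proof.
move=> e.
have {}e : (4 ^ k = 3 ^ k * 2 ^ m)%N.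
  apply/eqP; rewrite -(eqr_nat R) natrM !natrX; apply/eqP.
  have four : (4 : R) ^+ k = (4 / 3) ^+ k * 3 ^+ k.
    by rewrite -exprMn; congr (_ ^+ _); field.
  have one : (1 / 2 : R) ^+ m * 2 ^+ m = 1.
    by rewrite -exprMn -[RHS](expr1n _ m); congr (_ ^+ _); field.
  by rewrite -[RHS]mul1r -[X in _ = X * _]e four -[LHS]mulr1 -[X in _ * X = _]one; ring.
case: k e => [|k] e; last first.
  have : (3 %| 4 ^ k.+1)%N by rewrite e expnS -mulnA dvdn_mulr.
  by rewrite Euclid_dvdX.
by case: m e => [|m] //; rewrite expnS; lia.
Qed.

Lemma prod_gen_neq1 (w : seq nat) : w != [::] -> \prod_(j <- w) gen R j <> 1.
Proof.
move=> w0 e; have [_] := gen_prod_entries w.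
rewrite e mxE eqxx => /esym/four_thirds_half_indep.
rewrite addnC -[X in (_ + X)%N]/(count (predC (pred1 0%N)) w) count_predC => /size0nil wE _.
by rewrite wE in w0.
Qed.

(** The diagonal entries are positive and mutually inverse. *)
Lemma prod_gen_trace (w : seq nat) : 2 <= \tr (\prod_(j <- w) gen R j).
Proof.
have [_ M00 M11] := gen_prod_entries w.
rewrite /mxtrace sum_ord2.
set x := _ 0 0 in M00 M11 *; set y := _ 1 1 in M11 *.
have x0 : 0 < x by rewrite M00 mulr_gt0 // exprn_gt0 //; lra.
have : 0 <= (x - 1) ^+ 2 by exact: sqr_ge0.
have -> : (x - 1) ^+ 2 = x * (x + y - 2).
  by rewrite mulrBr mulrDr M11 expr2; ring.
by rewrite pmulr_rge0 // subr_ge0.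
Qed.

End Generators.

(** * The steered word and its linear growth *)

Section Steering.
Variable R : realFieldType.
Implicit Types (B : 'I_3 -> 'M[R]_2) (M : 'M[R]_2).

(* The vector (M 0 1, M 1 1) is the image of (0, 1); a contraction of the
   projective line lengthens it and an expansion shortens it. *)
Definition steer M : 'I_3 :=
  if M 1 1 < 1 then 0 else if M 0 1 <= 0 then 1 else 2%:R.

Fixpoint orbit B n : 'M[R]_2 :=
  if n is n'.+1 then B (steer (orbit B n')) * orbit B n' else 1.

(** [M 0 1 / M 1 1] is the image of 0 on the projective line; the last bound controls the shear. *)
Definition balanced (n : nat) M : Prop :=
  [/\ \det M = 1, `|M 0 1| <= 9 / 10 * M 1 1, 1 / 2 <= M 1 1 <= 4
    & `|M 1 0| <= n%:R * M 1 1].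

(** As [\det M = 1], the ratio [M 1 0 / M 1 1] changes by [g 1 0] over the product of the old and
    new lower right entries, which is at least 1/4. *)
Lemma balanced_mul n g M :
  \det g = 1 -> `|g 1 0| <= 1 / 100 ->
  `|(g * M) 0 1| <= 9 / 10 * (g * M) 1 1 -> 1 / 2 <= (g * M) 1 1 <= 4 ->
  balanced n M -> balanced n.+1 (g * M).
Proof.
move=> dg cg p' q'b [dM pb qb Cb]; split=> //.
  by rewrite det_mulmx dg dM mulr1.
have q'E : (g * M) 1 1 = g 1 0 * M 0 1 + g 1 1 * M 1 1 by rewrite mulmx2E.
have CE : M 1 1 * (g * M) 1 0 = g 1 0 + M 1 0 * (g * M) 1 1.
  rewrite q'E mulmx2E; move: dM; rewrite det_mx2 => dM.
  by rewrite -[X in _ = X + _]mulr1 -dM; ring.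
set q' := (g * M) 1 1 in q'b p' q'E CE *; set C' := (g * M) 1 0 in CE *.
set q := M 1 1 in qb pb Cb CE *.
have q0 : 0 < q by lra.
rewrite -(ler_pM2l q0) -{1}(gtr0_norm q0) -normrM CE.
apply: le_trans (ler_normD _ _) _; rewrite normrM (ger0_norm (_ : 0 <= q')); last lra.
have : `|M 1 0| * q' <= n%:R * q * q' by rewrite ler_wpM2r //; lra.
have : 1 / 2 * (1 / 2) <= q * q' by apply: ler_pM; lra.
rewrite -[n.+1%:R]natr1; nra.
Qed.

Lemma balanced_orbit B n :
  (forall k, \det (B k) = 1) ->
  (forall k i j, `|B k i j - gen R k i j| <= 1 / 100) ->
  balanced n (orbit B n).
Proof.
move=> dB nB; elim: n => [|n IH] /=.
  by split; rewrite ?det1 // !mxE /= ?normr0; lra.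
set M := orbit B n in IH *; have [dM pb qb Cb] := IH.
set g := B (steer M).
have prodb i j y : `|g i j * y - gen R (steer M) i j * y| <= 1 / 100 * `|y|.
  by rewrite -mulrBl normrM ler_wpM2r ?nB.
have c0 : gen R (steer M) 1 0 = 0.
  by case: (steer M) => -[|[|k]] ? /=; rewrite !mxE.
have cg : `|g 1 0| <= 1 / 100 by have := nB (steer M) 1 0; rewrite c0 subr0.
have := prodb 0 0 (M 0 1); have := prodb 0 1 (M 1 1).
have := prodb 1 0 (M 0 1); have := prodb 1 1 (M 1 1).
rewrite c0 mul0r subr0 (ger0_norm (_ : 0 <= M 1 1)); last lra.
have p'E : (g * M) 0 1 = g 0 0 * M 0 1 + g 0 1 * M 1 1 by rewrite mulmx2E.
have q'E : (g * M) 1 1 = g 1 0 * M 0 1 + g 1 1 * M 1 1 by rewrite mulmx2E.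
move: pb p'E q'E.
set p := M 0 1; set q := M 1 1 in qb *.
set ap := g 0 0 * p; set bq := g 0 1 * q; set cp := g 1 0 * p; set dq := g 1 1 * q.
move=> pb p'E q'E dqb cpb bqb apb.
suff [p'b q'b] : `|(g * M) 0 1| <= 9 / 10 * (g * M) 1 1 /\ 1 / 2 <= (g * M) 1 1 <= 4.
  by apply: balanced_mul => //; exact: dB.
have {}cpb : `|cp| <= 9 / 1000 * q by lra.
have {}apb : `|ap - gen R (steer M) 0 0 * p| <= 9 / 1000 * q by lra.
(* Unperturbed, the contraction doubles [q < 1] and halves [p]. An expansion sends [q] to 3/4 [q]
   and [p] to at most 37/60 [q] in absolute value, below the required 27/40 [q] by a margin that
   absorbs the errors. *)
move: apb pb dqb cpb bqb; rewrite /steer -/p -/q.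
rewrite p'E q'E {p'E q'E} !ler_norml; case: ifP => q1; last case: ifP => p0.
- by rewrite /= !mxE /=; lra.
- by rewrite /= !mxE /=; lra.
- by move/negbT: p0; rewrite -ltNge => p0; rewrite /= !mxE /=; lra.
Qed.

(** The entry [M 0 0] is recovered from the determinant, dividing by [M 1 1 >= 1/2]. *)
Lemma balanced_entry n M i j : balanced n M -> `|M i j| <= 4 * n.+1%:R.
Proof.
move=> [dM pb qb Cb]; move: dM; rewrite det_mx2.
have n0 : 0 <= n%:R :> R by [].
rewrite -[n.+1%:R]natr1.
have {}Cb : `|M 1 0| <= 4 * n%:R by nra.
move: j i; apply: forall_ord2; apply: forall_ord2 => dM; last first.
- by rewrite ger0_norm; lra.
- lra.
- lra.
have q0 : 0 < M 1 1 by lra.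
rewrite -(ler_pM2r q0) -{1}(gtr0_norm q0) -normrM.
have -> : M 0 0 * M 1 1 = 1 + M 0 1 * M 1 0 by rewrite -dM; ring.
apply: le_trans (ler_normD _ _) _; rewrite normr1 normrM.
have : `|M 0 1| * `|M 1 0| <= 9 / 10 * M 1 1 * (4 * n%:R) by apply: ler_pM.
nra.
Qed.

(** This matches the indexing in [uniformly_hyperbolic]. *)
Lemma orbit_prod B n :
  orbit B n.+1 = \prod_(k < n.+1) B (steer (orbit B (n - k))).
Proof.
elim: n => [|n IH]; first by rewrite big_ord_recl big_ord0.
by rewrite big_ord_recl subn0 [LHS]/= -/(orbit B n.+1) {2}IH.
Qed.

End Steering.

(** * Linear growth against uniform hyperbolicity *)

Section UniformHyperbolicity.
Variables (R : realType) (nrm : 'M[R]_2 -> R).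
Hypothesis nrm_norm : is_matrix_norm nrm.

Lemma matrix_norm_entry_bound :
  exists2 K : R, 0 < K &
    forall (M : 'M[R]_2) b, (forall i j, `|M i j| <= b) -> nrm M <= K * b.
Proof.
exists (1 + \sum_(i < 2) \sum_(j < 2) nrm (delta_mx i j)).
  rewrite ltr_pwDl //; apply: sumr_ge0 => i _; apply: sumr_ge0 => j _.
  exact: (matrix_norm_ge0 nrm_norm).
move=> M b Mb.
have b0 : 0 <= b by apply: le_trans (Mb 0 0).
rewrite mulrDl mul1r -[nrm M]add0r lerD //.
have nrmD := matrix_normD nrm_norm.
have nrmE i j : nrm (M i j *: delta_mx i j) <= nrm (delta_mx i j) * b.
  rewrite (matrix_normZ nrm_norm) mulrC ler_wpM2l ?Mb //.
  exact: (matrix_norm_ge0 nrm_norm).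
rewrite {1}[M]matrix_sum_delta !sum_ord2 !mulrDl.
by do 2![apply: le_trans (nrmD _ _) _; apply: lerD => //];
  apply: le_trans (nrmD _ _) _; apply: lerD.
Qed.

(** Squaring Bernoulli's inequality gives a quadratic lower bound at the even indices [2 * k]. *)
Lemma linear_growth_not_uniformly_hyperbolic (N : nat) (A : SL2_tuple R N)
    (i : nat -> 'I_N) (K : R) :
  (forall n, nrm (\prod_(k < n.+1) set_val (A (i (n - k)%N))) <= K * n.+2%:R) ->
  ~ uniformly_hyperbolic nrm A.
Proof.
move=> Kn [l [C [l1 C0 ge_exp]]].
pose e := l - 1; have e0 : 0 < e by rewrite subr_gt0.
have bernoulli k : 1 + k%:R * e <= l ^+ k.
  elim: k => [|k IH]; first by rewrite mul0r addr0.
  rewrite exprS -natr1 (_ : l = 1 + e); last by rewrite /e; ring.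
  have k0 : 0 <= k%:R :> R by [].
  move: IH; rewrite {1}(_ : l = 1 + e); last by rewrite /e; ring.
  by move: (_ ^+ k) => x IH; nra.
have quad k : C * (1 + k%:R * e) ^+ 2 <= K * (2 * k + 2)%:R.
  have := le_trans (ge_exp i (2 * k)%N) (Kn (2 * k)%N).
  rewrite addn2; apply: le_trans; rewrite ler_pM2l // mulnC exprM.
  have ke0 : 0 <= k%:R * e by rewrite mulr_ge0 // ltW.
  by apply: lerXn2r (bernoulli k); rewrite nnegrE ?exprn_ge0 //; lra.
have Ce0 : 0 < C * e ^+ 2 by rewrite mulr_gt0 // exprn_gt0.
(* The successor ensures [k >= 1], so that [2 * k + 2 <= 4 * k]. *)
pose k := (Num.bound `|4 * K / (C * e ^+ 2)|).+1.
have := quad k; rewrite natrD natrM.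
have : 4 * K / (C * e ^+ 2) < k%:R.
  apply: le_lt_trans (ler_norm _) _.
  by apply: lt_trans (archi_boundP (normr_ge0 _)) _; rewrite ltr_nat.
rewrite ltr_pdivrMr //.
have : 1 <= k%:R :> R by rewrite ler1n.
have K0 : 0 < K by have := quad 0%N; rewrite mul0r addr0 expr1n; lra.
move: (k%:R) => x x1 Kx.
have : x * (4 * K) < x * (x * (C * e ^+ 2)) by rewrite ltr_pM2l //; lra.
have : 0 <= C * (x * e) by rewrite !mulr_ge0 //; lra.
nra.
Qed.

End UniformHyperbolicity.

Section Counterexample.
Variables (R : realType) (N : nat).

(** From index 2 on, the second expansion is repeated. *)
Definition gen_tuple : SL2_tuple R N :=
  fun j => SigSub (mem_set (det_gen R j : SL2 R (gen R j))).

Lemma gen_tuple_not_elliptic : ~ elliptic_locus R N gen_tuple.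
Proof.
move=> [_ [w w0 ->]].
rewrite (_ : \prod_(j <- w) _ = \prod_(j <- map val w) gen R j); last first.
  by rewrite big_map.
case => [|[_]]; first by apply: prod_gen_neq1; case: w w0.
by have := prod_gen_trace R (map val w); rewrite ltNge => /le_trans -> //; exact: ler_norm.
Qed.

Lemma nbhs_gen_tuple (e : R) : 0 < e ->
  nbhs gen_tuple [set A : SL2_tuple R N |
    forall j a b, `|set_val (A j) a b - gen R j a b| <= e].
Proof.
move=> e0.
suff near_entry j a b : nbhs gen_tuple
    [set A : SL2_tuple R N | `|set_val (A j) a b - gen R j a b| <= e].
  have near_row j a := filter_forall (nbhs_filter gen_tuple) (near_entry j a).
  have near_mx j := filter_forall (nbhs_filter gen_tuple) (near_row j).
  exact: filter_forall (nbhs_filter gen_tuple) near_mx.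
have entry_cont : {for gen_tuple, continuous (fun A : SL2_tuple R N => set_val (A j) a b)}.
  apply: (@continuous_comp _ _ _ (fun A : SL2_tuple R N => set_val (A j))
    (fun M : 'M[R]_2 => M a b)); last exact: coord_continuous.
  apply: (@continuous_comp _ _ _ (fun A : SL2_tuple R N => A j) set_val).
    exact: proj_continuous.
  exact: initial_continuous.
apply: (@filterS _ (nbhs gen_tuple) _ _ _ _
  (entry_cont (ball (gen R j a b) e) (nbhsx_ballx _ _ e0))) => A.
by rewrite /= /ball /= distrC => /ltW.
Qed.

End Counterexample.

Theorem mainTheorem2 (R : realType) (nrm : 'M[R]_2 -> R)
    (nrm_norm : is_matrix_norm nrm) (N : nat) (N_ge3 : (3 <= N)%N) :
  closure (hyperbolic_locus nrm N) <> ~` elliptic_locus R N.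
Proof.
move=> clE.
have : closure (hyperbolic_locus nrm N) (@gen_tuple R N).
  by rewrite clE; exact: gen_tuple_not_elliptic.
have e0 : 0 < 1 / 100 :> R by lra.
move/(_ _ (@nbhs_gen_tuple R N _ e0)) => [A [hypA nearA]].
(* The steered word uses the first three matrices of the nearby hyperbolic tuple [A]. *)
pose B (k : 'I_3) := set_val (A (widen_ord N_ge3 k)).
have dB k : \det (B k) = 1 by exact: (set_valP (A (widen_ord N_ge3 k))).
have nB k i j : `|B k i j - gen R k i j| <= 1 / 100 by exact: nearA.
have [K K0 nrmK] := matrix_norm_entry_bound nrm_norm.
apply: (@linear_growth_not_uniformly_hyperbolic _ _ _ _
  (fun n => widen_ord N_ge3 (steer (orbit B n))) (K * 4) _ hypA) => n.
rewrite -mulrA; apply: nrmK => i j.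
have := balanced_entry i j (balanced_orbit n.+1 dB nB).
by rewrite orbit_prod; apply.
Qed.
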